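(* Let $1<p<\infty$ and let $\psi:\mathbb{N}\cup\{0\}\to\mathbb{R}$ be finitely supported with $\psi(0)=0$. Then $$\sum_{n=1}^{\infty}\max\left\{\sup_{m\in\mathbb{N},\,m\le n}\frac{|\psi(m)|^p}{n^p},\ \sup_{m\in\mathbb{N},\,m\ge n}\frac{|\psi(m)|^p}{m^p}\right\}\ \le\ \left(\frac{p}{p-1}\right)^p\sum_{n=1}^{\infty}|\nabla\psi(n)|^p ,$$ where $\nabla\psi(n):=\psi(n)-\psi(n-1)$ for $n\ge1$. Moreover, the constant $\left(\frac{p}{p-1}\right)^p$ is sharp: for each $1<p<\infty$, it cannot be replaced by any smaller constant such that the inequality remains valid for all finitely supported $\psi$ with $\psi(0)=0$.
   Context: $\mathbb{N}=\{1,2,3,\dots\}$. A function is finitely supported if it vanishes at all but finitely many points. A finitely supported function $\psi$ on $\mathbb{N}$ is extended to $0$ by the Dirichlet boundary condition $\psi(0)=0$. *)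

(* Defs.v *)
From HB Require Import structures.
From mathcomp Require Import all_boot all_order all_algebra.
From mathcomp Require Import all_classical all_reals all_analysis.

Set Implicit Arguments.
Unset Strict Implicit.
Unset Printing Implicit Defensive.

Import Order.TTheory GRing.Theory Num.Theory.

Local Open Scope classical_set_scope.
Local Open Scope ring_scope.

(* Index 0 only carries the Dirichlet boundary condition. *)
Definition dirichlet_fin_supp (R : realType) (psi : nat -> R) : Prop :=
  finite_set [set n | psi n != 0] /\ psi 0%N = 0.

(* Only used for n >= 1: since 0.-1 = 0, its value at n = 0 is meaningless. *)
Definition grad (R : realType) (psi : nat -> R) (n : nat) : R :=
  psi n - psi n.-1.

Definition hardy_max (R : realType) (p : R) (psi : nat -> R) (n : nat)
    : \bar R :=
  maxe
    (ereal_sup [set (`|psi m| `^ p / n%:R `^ p)%:E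
               | m in [set m : nat | (1 <= m)%N /\ (m <= n)%N]])
    (ereal_sup [set (`|psi m| `^ p / m%:R `^ p)%:E
               | m in [set m : nat | (1 <= m)%N /\ (n <= m)%N]]).

(* All terms of both series are nonnegative for n >= 1, so the sums are well
   defined in the extended reals. *)
Definition hardy_ineq (R : realType) (p C : R) (psi : nat -> R) : Prop :=
  (\sum_(1 <= n <oo) hardy_max p psi n
     <= C%:E * \sum_(1 <= n <oo) (`|grad psi n| `^ p)%:E)%E.

(* Main.v *)
(* Upper bound.  Let b be the decreasing rearrangement of |grad psi|, with
   partial sums B.  Then |psi m| <= B m for every m, and since the means B m / m
   decrease in m, both suprema at n are at most (B n / n)^p.  As rearranging
   preserves the p-energy, the classical Hardy inequality for b finishes.

   Sharpness.  For psi n = n^(1 - 1/p) up to N, continued linearly to 0 on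
   [N, 2N], the terms m = n alone contribute the harmonic sum H_N on the left,
   while the p-energy is at most 2 + ((p-1)/p)^p H_N; let N tend to infinity. *)

Require Import Defs.
From HB Require Import structures.
From mathcomp Require Import all_boot all_order all_algebra.
From mathcomp Require Import all_classical all_reals all_analysis.
From mathcomp Require Import ring lra.

Import Order.TTheory GRing.Theory Num.Theory.

Local Open Scope ring_scope.

(** * Young's inequality and Hardy's inequality for finite sums *)

Lemma powR_div (R : realType) (p x y : R) : 0 <= x -> 0 <= y ->
  (x / y) `^ p = x `^ p / y `^ p.
Proof.
move=> x0 y0; rewrite powRM ?invr_ge0//; congr (_ * _).
by rewrite -powR_inv1// powRAC powR_inv1 ?powR_ge0.
Qed.

(** Young's inequality for the conjugate exponents p/(p-1) and p, applied to x^(p-1) and y. *)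
Lemma young_powR (R : realType) (p x y : R) : 1 < p -> 0 <= x -> 0 <= y ->
  x `^ (p - 1) * y <= (p - 1) / p * x `^ p + y `^ p / p.
Proof.
move=> p1 x0 y0.
have p0 : p != 0 by lra.
have q0 : p - 1 != 0 by lra.
have -> : x `^ p = (x `^ (p - 1)) `^ (p / (p - 1)).
  by rewrite -powRrM mulrCA divff ?mulr1.
rewrite [_ / p * _]mulrC -[(p - 1) / p]invf_div.
apply: conjugate_powR; rewrite ?powR_ge0 ?divr_gt0//; try lra.
by field; apply/andP.
Qed.

(* With a, c the means of the first k and k + 1 terms, (k + 1) * c - k * a is the
   last term; summing over k telescopes to Hardy's inequality. *)
Lemma hardy_step (R : realType) (p a c k : R) : 1 < p ->
  0 <= a -> 0 <= c -> 0 <= k -> k * a <= (k + 1) * c ->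
  c `^ p + p / (p - 1) * ((k + 1) * c `^ p) <=
  p / (p - 1) * (k * a `^ p) +
  (p / (p - 1)) `^ p * ((k + 1) * c - k * a) `^ p.
Proof.
move=> p1 a0 c0 k0 kac.
have p0 : 0 < p by lra.
have q0 : 0 < p / (p - 1) by apply: divr_gt0; lra.
have b0 : 0 <= (k + 1) * c - k * a by lra.
rewrite -powRM ?(ltW q0)//.
(* With q = p/(p-1), Young is applied to [c] and q times the last term, then to [c] and [a].
   Weighted by p and p q k and added, the mixed terms c^(p-1) k a cancel, because p q = p + q. *)
have := young_powR _ _ _ _ p1 c0 (mulr_ge0 (ltW q0) b0).
have := young_powR _ _ _ _ p1 c0 a0.
have := mulr_powRB1 c0 p0.
set X := c `^ p; set W := c `^ (p - 1); set Z := (_ * _) `^ p; set Y := a `^ p.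
move=> <-; set q := p / (p - 1) in q0 *.
have qE : q * (p - 1) = p by rewrite /q; field; lra.
move=> Y2 Y1.
have := ler_wpM2l (ltW p0) Y1.
have := ler_wpM2l (mulr_ge0 (ltW q0) k0) (ler_wpM2l (ltW p0) Y2).
rewrite !mulrDr ![p * (_ / p * _)]mulrA ![p * (_ / p)]mulrCA divff ?gt_eqF// !mulr1.
have -> : q * k * ((p - 1) * (c * W)) = p * k * (c * W) by rewrite -[in RHS]qE; ring.
have E x : p * (W * (q * x)) = (p + q) * (W * x) by rewrite -[in RHS]qE; ring.
rewrite !E; have -> : q * k * (p * (W * a)) = (p + q) * (W * (k * a)).
  by rewrite -E; ring.
by move=> H1 H2; lra.
Qed.

Lemma hardy_finite (R : realType) (p : R) (b : nat -> R) (N : nat) : 1 < p ->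
  (forall n, 0 <= b n) ->
  \sum_(0 <= n < N) ((\sum_(0 <= k < n.+1) b k) / n.+1%:R) `^ p <=
  (p / (p - 1)) `^ p * \sum_(0 <= n < N) b n `^ p.
Proof.
move=> p1 b0; pose A n := (\sum_(0 <= k < n) b k) / n%:R.
have A0 n : 0 <= A n by rewrite divr_ge0// sumr_ge0.
have AE n : n%:R * A n = \sum_(0 <= k < n) b k.
  case: n => [|n]; first by rewrite mul0r big_geq.
  by rewrite /A mulrCA divff ?mulr1// pnatr_eq0.
have q0 : 0 < p / (p - 1) by apply: divr_gt0; lra.
(* The extra term q N A_N^p, with q = p/(p-1), makes the induction telescope; being nonnegative, it
   can then be dropped. *)
suff : \sum_(0 <= n < N) A n.+1 `^ p + p / (p - 1) * (N%:R * A N `^ p) <=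
    (p / (p - 1)) `^ p * \sum_(0 <= n < N) b n `^ p.
  apply: le_trans; rewrite lerDl mulr_ge0 ?(ltW q0)//.
  by rewrite mulr_ge0 ?powR_ge0.
elim: N => [|N IH]; first by rewrite !big_geq// !mul0r !mulr0 addr0.
have bE : b N = (N%:R + 1) * A N.+1 - N%:R * A N.
  by rewrite natr1 !AE big_nat_recr//= addrAC subrr add0r.
have := hardy_step _ _ (A N) (A N.+1) N%:R p1 (A0 _) (A0 _) (ler0n _ _).
rewrite -bE -subr_ge0 -bE => /(_ (b0 _)).
rewrite !big_nat_recr//= mulrDr -natr1.
by lra.
Qed.

(** * Sorted sequences and the decreasing rearrangement *)

Lemma nth_all_ge0 (R : realType) (s : seq R) (i : nat) :
  all (>= 0) s -> 0 <= nth 0 s i.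
Proof.
move=> s0; have [si|si] := ltnP i (size s); last by rewrite nth_default.
exact: (allP s0 _ (mem_nth _ si)).
Qed.

(** Past the end of [s] the default value 0 respects the order because the entries are
    nonnegative. *)
Lemma nth_sorted_nonincreasing (R : realType) (s : seq R) (i j : nat) :
  sorted >=%O s -> all (>= 0) s -> (i <= j)%N -> nth 0 s j <= nth 0 s i.
Proof.
move=> ss s0 ij; have [sj|sj] := ltnP j (size s).
  apply: (sorted_leq_nth _ _ _ ss) => //.
  - exact: rev_trans le_trans.
  - exact: lexx.
  - by rewrite inE (leq_ltn_trans ij).
by rewrite nth_default// nth_all_ge0.
Qed.

(* Subtracting the threshold c = nth 0 s m, the left sum is at most the sum of
   the positive parts over all of t, which equals that over s, where only the
   first m terms survive. *)
Lemma sum_take_sorted (R : realType) (s t : seq R) (m : nat) :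
  sorted >=%O s -> perm_eq s t -> all (>= 0) s ->
  \sum_(0 <= k < m) nth 0 t k <= \sum_(0 <= k < m) nth 0 s k.
Proof.
move=> ss st s0; pose c := nth 0 s m; pose f x := Num.max (x - c) 0.
have f0 x : 0 <= f x by rewrite /f le_max lexx orbT.
have mono i j := nth_sorted_nonincreasing _ s i j ss s0.
suff : \sum_(0 <= k < m) (nth 0 t k - c) <= \sum_(0 <= k < m) (nth 0 s k - c).
  by rewrite !big_split lerD2r.
(* As c >= 0, the default entries past the end contribute nothing to sums of [f], so index ranges
   may be prolonged freely. *)
have f00 : f 0 = 0 by rewrite /f sub0r max_r// oppr_le0 nth_all_ge0.
have fD u n :
    \sum_(0 <= k < size u + n) f (nth 0 u k) = \sum_(x <- u) f x.
  rewrite (big_cat_nat _ (n := size u))//= ?leq_addr// [RHS](big_nth 0).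
  rewrite [X in _ + X]big_nat_cond [X in _ + X]big1 ?addr0//.
  move=> i /andP[/andP[ui _] _].
  by rewrite nth_default.
pose M := (size s + m)%N.
have mM : (m <= M)%N by rewrite leq_addl.
have tM : \sum_(0 <= k < M) f (nth 0 t k) = \sum_(0 <= k < M) f (nth 0 s k).
  by rewrite {1}/M (perm_size st) !fD// (perm_big _ st).
have sM : \sum_(0 <= k < M) f (nth 0 s k) = \sum_(0 <= k < m) (nth 0 s k - c).
  rewrite (big_cat_nat _ (n := m))//= [X in _ + X]big_nat_cond.
  rewrite [X in _ + X]big1 ?addr0.
    by apply: eq_big_nat => i /andP[_ im]; rewrite /f max_l// subr_ge0 mono// ltnW.
  by move=> i /andP[/andP[mi _] _]; rewrite /f max_r// subr_le0 mono.
rewrite -sM -tM (le_trans (y := \sum_(0 <= k < m) f (nth 0 t k)))//.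
  by apply: ler_sum => i _; rewrite /f le_max lexx.
by rewrite [leRHS](big_cat_nat _ (n := m))//= lerDl sumr_ge0.
Qed.

(** Each appended term is at most every earlier one, hence at most their mean. *)
Lemma mean_nonincreasing (R : realType) (b : nat -> R) (m n : nat) :
  (forall i j, (i <= j)%N -> b j <= b i) -> (0 < m)%N -> (m <= n)%N ->
  (\sum_(0 <= k < n) b k) / n%:R <= (\sum_(0 <= k < m) b k) / m%:R.
Proof.
move=> mono m0 /subnK <-; elim: (n - m)%N => [//|i]; apply: le_trans.
rewrite addSn; move: (i + m)%N (leq_trans m0 (leq_addl i m)) => {m0 i}k k0.
rewrite ler_pdivrMr ?ltr0n// mulrAC ler_pdivlMr ?ltr0n// big_nat_recr//=.
rewrite -natr1 mulrDl mulrDr lerD2l mulr1 mulrC mulr_natl.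
rewrite -{2}[k]subn0 -sumr_const_nat.
by apply: ler_sum_nat => j /andP[_ jk]; rewrite mono// ltnW.
Qed.

(** Otherwise the nondecreasing partial sums would be bounded, hence convergent. *)
Lemma harmonic_unbounded (R : realType) (M : R) :
  exists N : nat, M < \sum_(1 <= n < N.+1) n%:R^-1.
Proof.
apply: contrapT => H; apply: (@dvg_harmonic R).
apply: nondecreasing_is_cvgn.
  by apply: nondecreasing_series => n _ _; exact: harmonic_ge0.
exists M => _ [N _ <-]; rewrite leNgt; apply/negP => MN; apply: H; exists N.
by rewrite big_add1.
Qed.

Lemma norm_le_sum_grad (R : realType) (psi : nat -> R) (m : nat) : psi 0%N = 0 ->
  `|psi m| <= \sum_(0 <= k < m) `|grad psi k.+1|.
Proof.
move=> psi0; rewrite -[psi m]subr0 -{1}psi0 -(telescope_sumr _ (leq0n m)).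
exact: ler_norm_sum.
Qed.

Lemma grad_rearrangement (R : realType) (psi : nat -> R) (p : R) (M : nat) :
  dirichlet_fin_supp psi ->
  exists K (b : nat -> R), [/\ (M <= K)%N, forall n, 0 <= b n,
    forall i j, (i <= j)%N -> b j <= b i,
    forall m, `|psi m| <= \sum_(0 <= k < m) b k &
    \sum_(0 <= k < K) b k `^ p = \sum_(0 <= k < K) `|grad psi k.+1| `^ p].
Proof.
move=> [/finite_seqP[u uE] psi0].
(* Increments up to index [K] suffice, even if the one at K + 1 is nonzero: for m <= K they
   telescope to [psi m], and for m > K [psi m] vanishes. *)
pose K := maxn M (\max_(i <- u) i).
pose t := mkseq (fun k => `|grad psi k.+1|) K; pose s := sort >=%O t.
have sz : size s = K by rewrite size_sort size_mkseq.
have st : perm_eq s t by rewrite perm_sort.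
have ss : sorted >=%O s by apply: sort_sorted => x y; exact: le_total.
have s0 : all (>= 0) s.
  by rewrite (perm_all _ st); apply/allP => x /mapP[k _ ->]; exact: normr_ge0.
exists K, (nth 0 s); split => //.
- exact: leq_maxl.
- by move=> n; exact: nth_all_ge0.
- by move=> i j; exact: nth_sorted_nonincreasing.
- move=> m; have [mK|Km] := leqP m K.
    apply: le_trans (sum_take_sorted _ _ _ m ss st s0).
    apply: (le_trans (norm_le_sum_grad _ _ _ psi0)).
    apply: ler_sum_nat => k /andP[_ km].
    by rewrite nth_mkseq// (leq_trans km).
  suff -> : psi m = 0 by rewrite normr0 sumr_ge0// => k _; exact: nth_all_ge0.
  apply/eqP/negPn/negP => psim.
  have : [set` u]%classic m by rewrite -uE.
  move=> /= mu; move: Km; rewrite ltnNge => /negP; apply.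
  by rewrite leq_max (@leq_bigmax_seq _ _ _ id)// orbT.
- rewrite -[in LHS]sz -(big_nth 0 predT (fun x => x `^ p)) (perm_big _ st)/=.
  by rewrite big_map /index_iota subn0.
Qed.

(** * Bounds on the maximal terms and the upper estimate *)

Lemma hardy_max_ge (R : realType) (p : R) (psi : nat -> R) (n : nat) : (0 < n)%N ->
  ((`|psi n| `^ p / n%:R `^ p)%:E <= hardy_max p psi n)%E.
Proof.
move=> n0; rewrite /hardy_max le_max; apply/orP; left.
by apply: ereal_sup_ubound; exists n.
Qed.

Lemma hardy_max_ge0 (R : realType) (p : R) (psi : nat -> R) (n : nat) : (0 < n)%N ->
  (0 <= hardy_max p psi n)%E.
Proof.
move=> n0; apply: le_trans (hardy_max_ge _ p psi n n0).
by rewrite lee_fin divr_ge0// powR_ge0.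
Qed.

(** For m <= n the partial sums of [b] grow over the common denominator n; for m >= n the means of
    [b] decrease. *)
Lemma hardy_max_le (R : realType) (p : R) (psi b : nat -> R) (n : nat) :
  0 <= p -> (0 < n)%N -> (forall i, 0 <= b i) ->
  (forall i j, (i <= j)%N -> b j <= b i) ->
  (forall m, `|psi m| <= \sum_(0 <= k < m) b k) ->
  (hardy_max p psi n <= (((\sum_(0 <= k < n) b k) / n%:R) `^ p)%:E)%E.
Proof.
move=> p0 n0 b0 mono psib.
have S0 k : 0 <= \sum_(0 <= i < k) b i by rewrite sumr_ge0.
rewrite /hardy_max ge_max; apply/andP; split;
  apply: ge_ereal_sup => _ [m [m1 mn] <-];
  rewrite lee_fin -powR_div// ge0_ler_powR ?nnegrE ?divr_ge0//.
  rewrite ler_pM2r ?invr_gt0 ?ltr0n//; apply: (le_trans (psib m)).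
  by rewrite [leRHS](big_cat_nat _ (n := m))//= lerDl sumr_ge0.
apply: le_trans (mean_nonincreasing _ b n m mono n0 mn).
by rewrite ler_pM2r ?invr_gt0 ?ltr0n.
Qed.

Lemma hardy_upper (R : realType) (p : R) (psi : nat -> R) : 1 < p ->
  dirichlet_fin_supp psi -> hardy_ineq p ((p / (p - 1)) `^ p) psi.
Proof.
move=> p1 dpsi; rewrite /hardy_ineq.
have p0 : 0 <= p by lra.
(* Only partial sums on the left need a bound, so the rearrangement may depend on the cutoff [M]. *)
apply: lime_le.
  by apply: is_cvg_nneseries => n n1 _; exact: hardy_max_ge0.
apply: nearW => M.
have [K [b [MK b0 mono psib bE]]] := grad_rearrangement _ _ p M dpsi.
apply: (@le_trans _ _ (\sum_(0 <= n < K)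
    (((\sum_(0 <= k < n.+1) b k) / n.+1%:R) `^ p)%:E)%E).
  apply: (@le_trans _ _ (\sum_(1 <= n < K.+1) hardy_max p psi n)%E).
    apply: lee_sum_nneg_natr.
      by move=> n n1 _; exact: hardy_max_ge0.
    exact: leqW.
  rewrite big_add1/=; apply: lee_sum => n _.
  by apply: hardy_max_le.
rewrite sumEFin.
apply: (@le_trans _ _ ((p / (p - 1)) `^ p * \sum_(0 <= k < K) b k `^ p)%:E).
  by rewrite lee_fin hardy_finite.
rewrite bE EFinM lee_wpmul2l ?lee_fin ?powR_ge0//.
apply: (@le_trans _ _ (\sum_(1 <= n < K.+1) (`|grad psi n| `^ p)%:E)%E).
  by rewrite big_add1 sumEFin.
by apply: nneseries_lim_ge => n _ _; rewrite lee_fin powR_ge0.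
Qed.

(** * The test functions and their energy *)

(* The truncated subtraction makes this vanish beyond 2 * N. *)
Definition truncated_power (R : realType) (beta : R) (N n : nat) : R :=
  if (n <= N)%N then n%:R `^ beta else N%:R `^ beta / N%:R * (2 * N - n)%:R.

(** A tangent bound without derivatives: Young for (x+1)^(1/p) and x^(1/p) gives (x+1)^((p-1)/p)
    x^(1/p) <= x + (p-1)/p; then divide by x^(1/p). *)
Lemma powR_increment_le (R : realType) (p x : R) : 1 < p -> 0 < x ->
  (x + 1) `^ ((p - 1) / p) - x `^ ((p - 1) / p) <= (p - 1) / p * x `^ (- p^-1).
Proof.
move=> p1 x0; have p0 : p != 0 by lra.
have x10 : 0 < x + 1 by lra.
have := young_powR _ p ((x + 1) `^ p^-1) (x `^ p^-1) p1
  (powR_ge0 _ _) (powR_ge0 _ _).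
rewrite -!powRrM mulVf// !powRr1 ?(ltW x0) ?(ltW x10)// [p^-1 * (p - 1)]mulrC.
have -> : (p - 1) / p * (x + 1) + x / p = x + (p - 1) / p by field.
have -> : x `^ ((p - 1) / p) = x * x `^ (- p^-1).
  rewrite -{2}[x]powRr1 ?(ltW x0)// -powRD; last by rewrite (gt_eqF x0) implybT.
  by congr (_ `^ _); field.
by rewrite powRN -ler_pdivlMr ?powR_gt0// mulrDl; lra.
Qed.

Section truncated_power.
Variables (R : realType) (p : R) (N : nat).
Hypotheses (p1 : 1 < p) (N0 : (0 < N)%N).
Let beta := (p - 1) / p.
Let psi := truncated_power _ beta N.

Let p_gt0 : 0 < p. Proof. exact: lt_trans p1. Qed.
Let beta_gt0 : 0 < beta. Proof. by rewrite divr_gt0 ?subr_gt0. Qed.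

(** As beta - 1 = -1/p, this produces the harmonic terms on the left and, at n = N, the slope of the
    descent. *)
Let powR_beta n : (0 < n)%N -> (n%:R `^ beta / n%:R) `^ p = n%:R^-1 :> R.
Proof.
move=> n0; have nR : 0 < n%:R :> R by rewrite ltr0n.
rewrite -{2}[n%:R]powRr1 ?ler0n// -powRB; last by rewrite (gt_eqF nR) implybT.
rewrite -powRrM -powR_inv1 ?ler0n//; congr (_ `^ _).
by rewrite /beta; field; rewrite gt_eqF.
Qed.

Lemma truncated_power_dirichlet : dirichlet_fin_supp psi.
Proof.
split; last by rewrite /psi /truncated_power leq0n powR0// gt_eqF.
apply: (sub_finite_set _ (finite_II (2 * N))) => n /= psin.
rewrite ltnNge; apply: contra_neqN psin => Nn.
rewrite /psi /truncated_power leqNgt (leq_trans _ Nn) ?ltn_Pmull//=.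
have /eqP -> : (2 * N - n == 0)%N by rewrite subn_eq0.
by rewrite mulr0.
Qed.

Lemma truncated_power_mass n : (0 < n)%N -> (n <= N)%N ->
  `|psi n| `^ p / n%:R `^ p = n%:R^-1.
Proof.
move=> n0 nN; rewrite /psi /truncated_power nN ger0_norm ?powR_ge0//.
by rewrite -powR_div ?powR_ge0// powR_beta.
Qed.

(** The jump away from 0 is treated apart because [powR_increment_le] requires x > 0. *)
Lemma truncated_power_grad1 : `|grad psi 1| `^ p = 1.
Proof.
rewrite /grad /psi /truncated_power /= N0 powR1 powR0 ?gt_eqF//.
by rewrite subr0 normr1 powR1.
Qed.

Lemma truncated_power_grad_rise n : (0 < n)%N -> (n < N)%N ->
  `|grad psi n.+1| `^ p <= beta `^ p * n%:R^-1.
Proof.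
move=> n0 nN; rewrite /grad /psi /truncated_power /= nN (ltnW nN).
have nR : 0 < n%:R :> R by rewrite ltr0n.
rewrite ger0_norm; last first.
  by rewrite subr_ge0 ge0_ler_powR ?nnegrE ?ler_nat// ltW.
apply: (@le_trans _ _ ((beta * n%:R `^ (- p^-1)) `^ p)).
  rewrite ge0_ler_powR ?nnegrE ?subr_ge0//; first exact: ltW.
  - by rewrite ge0_ler_powR ?nnegrE ?ler_nat// ltW.
  - by rewrite mulr_ge0 ?powR_ge0// ltW.
  - by rewrite -natr1; exact: powR_increment_le.
by rewrite powRM ?powR_ge0 ?(ltW beta_gt0)// -powRrM mulNr mulVf ?powR_inv1// gt_eqF.
Qed.

Lemma truncated_power_grad_fall n : (N <= n)%N -> (n < 2 * N)%N ->
  `|grad psi n.+1| `^ p = N%:R^-1.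
Proof.
move=> Nn n2N.
(* Both branches agree at k = N, so the linear formula covers the whole descent. *)
have psiE k : (N <= k)%N -> psi k = N%:R `^ beta / N%:R * (2 * N - k)%:R.
  rewrite leq_eqVlt /psi /truncated_power => /predU1P[<-|]; last first.
    by rewrite ltnNge => /negbTE ->.
  by rewrite leqnn mul2n -addnn addnK mulfVK// pnatr_eq0 -lt0n.
rewrite /grad /= !psiE//; last exact: leqW.
have -> : (2 * N - n = (2 * N - n.+1).+1)%N by rewrite subnSK.
by rewrite -mulrBr -natr1 opprD addNKr mulrN1 normrN ger0_norm ?powR_beta//.
Qed.

Lemma truncated_power_grad_tail n : (2 * N <= n)%N -> `|grad psi n.+1| `^ p = 0.
Proof.
move=> Nn; have psiE k : (2 * N <= k)%N -> psi k = 0.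
  move=> Nk; have /eqP kE : (2 * N - k == 0)%N by rewrite subn_eq0.
  by rewrite /psi /truncated_power leqNgt (leq_trans _ Nk) ?ltn_Pmull// kE mulr0.
by rewrite /grad /= !psiE ?(leqW Nn)// subr0 normr0 powR0// gt_eqF.
Qed.

(** The constant 2 is 1 from the first jump plus N times 1/N from the descent. *)
Lemma truncated_power_energy :
  (\sum_(1 <= n <oo) (`|grad psi n| `^ p)%:E <=
   (2 + beta `^ p * \sum_(1 <= n < N.+1) n%:R^-1)%:E)%E.
Proof.
apply: lime_le.
  by apply: is_cvg_nneseries => n _ _; rewrite lee_fin powR_ge0.
apply: nearW => M; rewrite sumEFin lee_fin.
apply: (@le_trans _ _ (\sum_(1 <= n < (2 * N + M).+1) `|grad psi n| `^ p)).
  (* The cut at max(M, 1) allows for M = 0, where the range starting at 1 is empty. *)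
  rewrite (@big_cat_nat _ _ _ (maxn M 1) 1 (2 * N + M).+1)//=; last 2 first.
  - exact: leq_maxr.
  - by rewrite geq_max leqW ?leq_addl.
  have [M1|M1] := leqP M 1.
    by rewrite big_geq// addr_ge0// sumr_ge0// => n _; rewrite powR_ge0.
  by rewrite lerDl sumr_ge0// => n _; rewrite powR_ge0.
have N2 : (N <= 2 * N)%N by rewrite leq_pmull.
rewrite big_add1/= (@big_cat_nat _ _ _ N)//=; last exact: leq_trans (leq_addr _ _).
rewrite (@big_cat_nat _ _ _ (2 * N)%N N)//= ?leq_addr//.
rewrite (@eq_big_nat _ _ _ N (2 * N)%N _ (fun=> N%:R^-1)); last first.
  by move=> n /andP[]; exact: truncated_power_grad_fall.
rewrite [X in _ + (_ + X)](@eq_big_nat _ _ _ (2 * N)%N _ _ (fun=> 0)); last first.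
  by move=> n /andP[+ _]; exact: truncated_power_grad_tail.
rewrite big1_eq addr0 sumr_const_nat mul2n -addnn addnK.
rewrite -[_^-1 *+ N]mulr_natr mulVf; last first.
  by rewrite pnatr_eq0 -lt0n.
rewrite big_ltn// truncated_power_grad1.
suff : \sum_(1 <= n < N) `|grad psi n.+1| `^ p <=
    beta `^ p * \sum_(1 <= n < N.+1) n%:R^-1 by lra.
rewrite big_nat_recr//= mulrDr mulr_sumr ler_wpDr ?mulr_ge0 ?powR_ge0//.
by apply: ler_sum_nat => n /andP[]; exact: truncated_power_grad_rise.
Qed.

End truncated_power.

(** * Sharpness of the constant *)

Lemma hardy_sharp (R : realType) (p C : R) : 1 < p -> C < (p / (p - 1)) `^ p ->
  ~ (forall psi : nat -> R, dirichlet_fin_supp psi -> hardy_ineq p C psi).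
Proof.
move=> p1 Cq H.
(* [C] may be negative; replacing it by [D] keeps the inequality and lets the energy bound be
   multiplied through. *)
pose D := Num.max C 0; pose g := ((p - 1) / p) `^ p.
have D0 : 0 <= D by rewrite le_max lexx orbT.
have gD : D * g < 1.
  have q0 : 0 < p / (p - 1) by apply: divr_gt0; lra.
  rewrite /g -[(p - 1) / p]invf_div -[_^-1]mul1r powR_div ?(ltW q0)// powR1 mul1r.
  by rewrite ltr_pdivrMr ?powR_gt0// mul1r gt_max Cq powR_gt0.
(* The test function will give h <= D (2 + g h) for the harmonic sum h, that is, h <= 2 D / (1 - D
   g); [N] is chosen to violate this. *)
have [N HN] := harmonic_unbounded _ (2 * D / (1 - D * g)).
have N0 : (0 < N)%N.
  rewrite lt0n; apply: contraTneq HN => ->; rewrite big_geq// -leNgt.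
  by rewrite divr_ge0 ?mulr_ge0// subr_ge0 ltW.
have := H _ (truncated_power_dirichlet _ p N p1 N0); rewrite /hardy_ineq.
set psi := truncated_power _ _ _; move=> HC.
move: HN; rewrite ltr_pdivrMr ?subr_gt0//; apply/negP; rewrite -leNgt.
set h := \sum_(1 <= n < N.+1) _.
suff : h <= D * (2 + g * h) by lra.
rewrite -lee_fin EFinM.
apply: (@le_trans _ _ (\sum_(1 <= n < N.+1) hardy_max p psi n)%E).
  rewrite /h -sumEFin !big_nat; apply: lee_sum => n /andP[n1 nN].
  rewrite -(truncated_power_mass _ p N p1 n n1 nN).
  exact: hardy_max_ge.
apply: (@le_trans _ _ (\sum_(1 <= n <oo) hardy_max p psi n)%E).
  by apply: nneseries_lim_ge => n n1 _; exact: hardy_max_ge0.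
apply: (le_trans HC).
apply: (@le_trans _ _ (D%:E * \sum_(1 <= n <oo) (`|grad psi n| `^ p)%:E)%E).
  rewrite lee_wpmul2r ?lee_fin ?le_max ?lexx//.
  by apply: nneseries_ge0 => n _ _; rewrite lee_fin powR_ge0.
by rewrite lee_wpmul2l ?lee_fin//; exact: truncated_power_energy.
Qed.

Theorem theorem3p2 (R : realType) (p : R) (hp : 1 < p) :
  (forall psi : nat -> R, dirichlet_fin_supp psi ->
     hardy_ineq p ((p / (p - 1)) `^ p) psi)
  /\
  (forall C : R, C < (p / (p - 1)) `^ p ->
     ~ (forall psi : nat -> R, dirichlet_fin_supp psi -> hardy_ineq p C psi)).
Proof.
split; first by move=> psi; exact: hardy_upper.
by move=> C; exact: hardy_sharp.
Qed.
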